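(* Let $\Delta$ be a finite set of conditional domain constraints (CDCs) and X-UINDs over $R$, where the CDCs are disjoint with respect to each X-UIND in $\Delta$. Then the X-UINDs are $\emptyset$-separable in $\Delta$ from the CDCs; that is, every horizontal decomposition of $R$ is lossless under $\Delta$ if and only if it is lossless under $\mathrm{cdc}(\Delta)$.
   Context: Setting. $\mathbf{dom}$ is a (possibly infinite) set of values; $\mathbf{idom}$ is a set of values from a specific interpreted domain (e.g. $\mathbb Z$) on which predicates and functions are defined according to a first-order language $\mathfrak C$ closed under negation. $R$ is a relation symbol of arity $n$ whose first $k$ positions are non-interpreted (values from $\mathbf{dom}$) and whose remaining $n-k$ positions are interpreted (values from $\mathbf{idom}$). Variables $\overline x=(x_1,\dots,x_k)$ refer to non-interpreted positions, $\overline y=(y_1,\dots,y_{n-k})$ to interpreted ones ($y_i$ refers to position $k+i$). $\mathfrak C$-formulae have free variables among $\overline y$; one is satisfiable if some assignment of values of $\mathbf{idom}$ to $\overline y$ makes it true. All instances (associating relation symbols with subsets of $\mathbf{dom}^k\times\mathbf{idom}^{n-k}$) are finite; entailment $\models$ is with respect to finite instances. A CDC is a formula $\forall\overline x,\overline y.\,(R(\overline x,\overline y)\land\lambda(\overline x))\to\delta(\overline y)$ with antecedent $\lambda$, a Boolean combination of equalities $x_i=a$ with $a\in\mathbf{dom}$ (possibly $\top$), and consequent $\delta(\overline y)\in\mathfrak C$. $\mathrm{cdc}(\Delta)$ is the set of all CDCs in $\Delta$. An X-UIND $R[x_i]\subseteq R[x_j]$ is a unary inclusion dependency between non-interpreted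 positions ($1\le i,j\le k$): it is satisfied by $I$ if every value in column $i$ of $R^I$ appears in column $j$ of $R^I$. Disjointness: the CDCs of $\Delta$ are disjoint with respect to an X-UIND $R[x_i]\subseteq R[x_j]$ if, for every CDC $\phi_1$ in $\Delta$ whose antecedent mentions $x_j$, the consequent of $\phi_1$ is satisfiable and has no variables in common with the consequent of any CDC $\phi_2$ in $\Delta$ distinct from $\phi_1$. A horizontal decomposition $\Sigma$ is a finite set of view definitions, one for each view symbol $V_1,\dots,V_m$ (each of the same arity and position types as $R$), of the form $\forall\overline x,\overline y.\,V_i(\overline x,\overline y)\leftrightarrow(R(\overline x,\overline y)\land\lambda_i(\overline x)\land\sigma_i(\overline y))$, with $\lambda_i$ a Boolean combination of equalities as for CDCs (possibly $\top$) and $\sigma_i\in\mathfrak C$; the conjunct $\sigma_i$ may be absent. $\Sigma$ is lossless under a set $\Gamma$ of constraints over $R$ if $\Gamma\cup\Sigma\models\forall\overline x,\overline y.\,R(\overline x,\overline y)\leftrightarrow\bigvee_iV_i(\overline x,\overline y)$. Separability: for a finite set $\mathcal S$ of sound inference rules, the constraints in $\Delta$ other than CDCs are $\mathcal S$-separable in $\Delta$ from the CDCs if every horizontal decomposition is lossless under $\Delta$ exactly when it is lossless under $\mathrm{cdc}(\Delta^* )$, with $\Delta^*$ the closure of $\Delta$ under $\mathcal S$ (so $\Delta^*=\Delta$ for $\mathcal S=\emptyset$). *)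

(* Defs.v *)
From mathcomp Require Import all_boot.
From mathcomp Require Import boolp classical_sets functions cardinality.

Set Implicit Arguments.
Unset Strict Implicit.
Unset Printing Implicit Defensive.

Local Open Scope classical_set_scope.

Record signature := Signature {
  fsym : Type; far : fsym -> nat;
  psym : Type; par : psym -> nat }.

Record structure (Sg : signature) (D : Type) := Structure {
  fint : forall f : fsym Sg, {ffun 'I_(far f) -> D} -> D;
  pint : forall p : psym Sg, {ffun 'I_(par p) -> D} -> Prop }.

(* Terms and formulae are well scoped: the index [m] bounds the free variables,
   so [formula Sg m] is the set of first-order formulae with free variables
   among y_0, ..., y_(m-1).  A quantifier binds variable [ord0] of its body,
   where the variable [i] of the context is renamed [lift ord0 i]. *)
Inductive term (Sg : signature) (m : nat) : Type :=
| TVar of 'I_m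
| TApp (f : fsym Sg) of {ffun 'I_(far f) -> term Sg m}.

Inductive formula (Sg : signature) : nat -> Type :=
| FBot m : formula Sg m
| FEq m of term Sg m & term Sg m : formula Sg m
| FPred m (p : psym Sg) of {ffun 'I_(par p) -> term Sg m} : formula Sg m
| FNot m of formula Sg m : formula Sg m
| FAnd m of formula Sg m & formula Sg m : formula Sg m
| FOr m of formula Sg m & formula Sg m : formula Sg m
| FImp m of formula Sg m & formula Sg m : formula Sg m
| FAll m of formula Sg m.+1 : formula Sg m
| FEx m of formula Sg m.+1 : formula Sg m.

Definition extend (D : Type) (m : nat) (d : D) (e : 'I_m -> D) : 'I_m.+1 -> D :=
  fun i => if unlift ord0 i is Some j then e j else d.

Fixpoint teval (Sg : signature) (D : Type) (M : structure Sg D) (m : nat)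
    (e : 'I_m -> D) (t : term Sg m) : D :=
  match t with
  | TVar i => e i
  | TApp f a => fint M [ffun i => teval M e (a i)]
  end.

Fixpoint holds (Sg : signature) (D : Type) (M : structure Sg D) (m : nat)
    (phi : formula Sg m) : ('I_m -> D) -> Prop :=
  match phi in formula _ m return ('I_m -> D) -> Prop with
  | FBot _ => fun _ => False
  | FEq _ s t => fun e => teval M e s = teval M e t
  | FPred _ _ a => fun e => pint M [ffun i => teval M e (a i)]
  | FNot _ f => fun e => ~ holds M f e
  | FAnd _ f g => fun e => holds M f e /\ holds M g e
  | FOr _ f g => fun e => holds M f e \/ holds M g e
  | FImp _ f g => fun e => holds M f e -> holds M g e
  | FAll _ f => fun e => forall d, holds M f (extend d e)
  | FEx _ f => fun e => exists d, holds M f (extend d e)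
  end.

Fixpoint tfv (Sg : signature) (m : nat) (t : term Sg m) : set 'I_m :=
  match t with
  | TVar i => [set i]
  | TApp f a => fun v => exists i, tfv (a i) v
  end.

Fixpoint fv (Sg : signature) (m : nat) (phi : formula Sg m) : set 'I_m :=
  match phi in formula _ m return set 'I_m with
  | FBot _ => set0
  | FEq _ s t => tfv s `|` tfv t
  | FPred _ _ a => fun v => exists i, tfv (a i) v
  | FNot _ f => fv f
  | FAnd _ f g | FOr _ f g | FImp _ f g => fv f `|` fv g
  | FAll _ f | FEx _ f => fun v => fv f (lift ord0 v)
  end.

Definition satisfiable (Sg : signature) (D : Type) (M : structure Sg D) (m : nat)
    (phi : formula Sg m) : Prop :=
  exists e : 'I_m -> D, holds M phi e.

(* Closure is up to logical equivalence in the interpreted domain, so that it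
   also covers fragments such as difference constraints over the integers, where
   the negation of [y - z <= c] is written [z - y <= - c - 1]; syntactic closure
   under [FNot] is a special case. *)
Definition closed_under_negation (Sg : signature) (D : Type) (M : structure Sg D)
    (m : nat) (C : set (formula Sg m)) : Prop :=
  forall phi, C phi ->
    exists2 psi, C psi & forall e, holds M psi e <-> ~ holds M phi e.

Inductive xcond (dom : Type) (k : nat) : Type :=
| XTrue
| XEq of 'I_k & dom
| XNot of xcond dom k
| XAnd of xcond dom k & xcond dom k
| XOr of xcond dom k & xcond dom k.
Arguments XTrue {dom k}.

Fixpoint xholds (dom : Type) (k : nat) (x : k.-tuple dom) (l : xcond dom k) : Prop :=
  match l with
  | XTrue => True
  | XEq i a => tnth x i = a
  | XNot l => ~ xholds x l
  | XAnd l l' => xholds x l /\ xholds x l'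
  | XOr l l' => xholds x l \/ xholds x l'
  end.

Fixpoint mentions (dom : Type) (k : nat) (j : 'I_k) (l : xcond dom k) : Prop :=
  match l with
  | XTrue => False
  | XEq i _ => i = j
  | XNot l => mentions j l
  | XAnd l l' | XOr l l' => mentions j l \/ mentions j l'
  end.

(* Below, [k] and [m] are the numbers of non-interpreted and of interpreted
   positions of the relation. *)
Definition fact (dom idom : Type) (k m : nat) : Type :=
  (k.-tuple dom * m.-tuple idom)%type.

Record cdc (Sg : signature) (dom : Type) (k m : nat) := MkCdc {
  antecedent : xcond dom k;
  consequent : formula Sg m }.

(* [XUind i j] is the inclusion dependency R[x_i] <= R[x_j]. *)
Inductive constraint (Sg : signature) (dom : Type) (k m : nat) : Type :=
| Cdc of cdc Sg dom k m
| XUind of 'I_k & 'I_k.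
Arguments XUind {Sg dom k m}.

Definition sat (Sg : signature) (dom idom : Type) (M : structure Sg idom)
    (k m : nat) (R : set (fact dom idom k m)) (c : constraint Sg dom k m) : Prop :=
  match c with
  | Cdc phi => forall t, R t -> xholds t.1 (antecedent phi) ->
                 holds M (consequent phi) (tnth t.2)
  | XUind i j => forall t, R t -> exists2 u, R u & tnth u.1 j = tnth t.1 i
  end.

Definition sat_all (Sg : signature) (dom idom : Type) (M : structure Sg idom)
    (k m : nat) (R : set (fact dom idom k m)) (G : set (constraint Sg dom k m)) :
    Prop :=
  forall c, G c -> sat M R c.

Definition cdcs (Sg : signature) (dom : Type) (k m : nat)
    (D : set (constraint Sg dom k m)) : set (constraint Sg dom k m) :=
  [set c | D c /\ exists phi, c = Cdc phi].

Definition consequents_in (Sg : signature) (dom : Type) (k m : nat)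
    (C : set (formula Sg m)) (D : set (constraint Sg dom k m)) : Prop :=
  forall phi, D (Cdc phi) -> C (consequent phi).

(* Disjointness with respect to R[x_i] <= R[x_j] depends only on [j]. *)
Definition disjoint_wrt (Sg : signature) (dom idom : Type) (M : structure Sg idom)
    (k m : nat) (D : set (constraint Sg dom k m)) (i j : 'I_k) : Prop :=
  forall phi1, D (Cdc phi1) -> mentions j (antecedent phi1) ->
    satisfiable M (consequent phi1) /\
    forall phi2, D (Cdc phi2) -> phi2 <> phi1 ->
      fv (consequent phi1) `&` fv (consequent phi2) = set0.

Record view (Sg : signature) (dom : Type) (k m : nat) := MkView {
  vcond : xcond dom k;
  vsel : option (formula Sg m) }.

(* The index set ['I_p] is the set of view symbols. *)
Definition decomposition (Sg : signature) (dom : Type) (k m p : nat) : Type :=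
  'I_p -> view Sg dom k m.

Definition decomposition_in (Sg : signature) (dom : Type) (k m p : nat)
    (C : set (formula Sg m)) (Sigma : decomposition Sg dom k m p) : Prop :=
  forall i s, vsel (Sigma i) = Some s -> C s.

Definition selected (Sg : signature) (dom idom : Type) (M : structure Sg idom)
    (k m : nat) (v : view Sg dom k m) (t : fact dom idom k m) : Prop :=
  xholds t.1 (vcond v) /\
  (if vsel v is Some s then holds M s (tnth t.2) else True).

Definition sat_views (Sg : signature) (dom idom : Type) (M : structure Sg idom)
    (k m p : nat) (R : set (fact dom idom k m))
    (V : 'I_p -> set (fact dom idom k m)) (Sigma : decomposition Sg dom k m p) : Prop :=
  forall i t, V i t <-> (R t /\ selected M (Sigma i) t).

Definition lossless (Sg : signature) (dom idom : Type) (M : structure Sg idom)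
    (k m p : nat) (G : set (constraint Sg dom k m))
    (Sigma : decomposition Sg dom k m p) : Prop :=
  forall (R : set (fact dom idom k m)) (V : 'I_p -> set (fact dom idom k m)),
    finite_set R -> (forall i, finite_set (V i)) ->
    sat_all M R G -> sat_views M R V Sigma ->
    forall t, R t <-> exists i, V i t.

(* An inference rule is given by its instances (premises, conclusion). *)
Definition rule (Sg : signature) (dom : Type) (k m : nat) : Type :=
  set (set (constraint Sg dom k m) * constraint Sg dom k m).

Definition sound (Sg : signature) (dom idom : Type) (M : structure Sg idom)
    (k m : nat) (r : rule Sg dom k m) : Prop :=
  forall P c, r (P, c) ->
    forall R : set (fact dom idom k m), finite_set R -> sat_all M R P -> sat M R c.

Inductive closure (Sg : signature) (dom : Type) (k m : nat)
    (Ru : set (rule Sg dom k m)) (D : set (constraint Sg dom k m)) :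
    constraint Sg dom k m -> Prop :=
| closure_base c : D c -> closure Ru D c
| closure_step r P c : Ru r -> r (P, c) ->
    (forall d, P d -> closure Ru D d) -> closure Ru D c.

Definition separable (Sg : signature) (dom idom : Type) (M : structure Sg idom)
    (k m : nat) (C : set (formula Sg m)) (Ru : set (rule Sg dom k m))
    (D : set (constraint Sg dom k m)) : Prop :=
  [/\ finite_set Ru, (forall r, Ru r -> sound M r) &
      forall (p : nat) (Sigma : decomposition Sg dom k m p), decomposition_in C Sigma ->
        lossless M D Sigma <-> lossless M (cdcs (closure Ru D)) Sigma].

(* Main.v *)
Require Import Defs.
From mathcomp Require Import all_boot.
From mathcomp Require Import boolp classical_sets functions cardinality.

(** A violation of losslessness is a single fact t that no view selects, and {t}
    satisfies the CDCs.  To repair the inclusion dependencies, add for each value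
    a of t the fact obtained from t by writing a at every position that is the
    target of a dependency, and changing y to an assignment y' that satisfies
    the consequents of all CDCs mentioning a target.  By disjointness y' exists
    and can be taken equal to y on the variables of the other consequents, whose
    antecedents do not distinguish the new facts from t. *)

Set Implicit Arguments.
Unset Strict Implicit.
Unset Printing Implicit Defensive.

Local Open Scope classical_set_scope.

Fixpoint eq_teval (Sg : signature) (D : Type) (M : structure Sg D) (m : nat)
    (e e' : 'I_m -> D) (t : term Sg m) :
  (forall v, tfv t v -> e v = e' v) -> teval M e t = teval M e' t.
Proof.
case: t => [i|f a] /= ee'; first exact: ee'.
congr (fint M _); apply/ffunP => i; rewrite !ffunE.
by apply: eq_teval => v av; apply: ee'; exists i.
Qed.

Lemma eq_holds (Sg : signature) (D : Type) (M : structure Sg D) (m : nat)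
    (phi : formula Sg m) (e e' : 'I_m -> D) :
  (forall v, fv phi v -> e v = e' v) -> holds M phi e <-> holds M phi e'.
Proof.
(* Both extensions give the bound variable the same value [d], so under a quantifier only the lifted
   variables matter. *)
have eq_extend p (f : formula Sg p.+1) (g g' : 'I_p -> D) d :
    (forall v, fv f (lift ord0 v) -> g v = g' v) ->
    forall v, fv f v -> extend d g v = extend d g' v.
  by move=> gg' v; rewrite /extend; case: unliftP => [j ->|//]; apply: gg'.
elim: phi e e' => {m} [m|m s t|m p a|m f IHf|m f IHf g IHg|m f IHf g IHg
  |m f IHf g IHg|m f IHf|m f IHf] e e' /= ee'.
- by [].
- rewrite (@eq_teval _ _ M _ e e' s) 1?(@eq_teval _ _ M _ e e' t) //.
  + by move=> v tv; apply: ee'; right.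
  + by move=> v sv; apply: ee'; left.
- suff -> : [ffun i => teval M e (a i)] = [ffun i => teval M e' (a i)] by [].
  apply/ffunP => i; rewrite !ffunE; apply: eq_teval => v av.
  by apply: ee'; exists i.
- by have := IHf _ _ ee'; tauto.
- have := IHf e e' (fun v fvv => ee' v (or_introl fvv)).
  by have := IHg e e' (fun v fvv => ee' v (or_intror fvv)); tauto.
- have := IHf e e' (fun v fvv => ee' v (or_introl fvv)).
  by have := IHg e e' (fun v fvv => ee' v (or_intror fvv)); tauto.
- have := IHf e e' (fun v fvv => ee' v (or_introl fvv)).
  by have := IHg e e' (fun v fvv => ee' v (or_intror fvv)); tauto.
- by split=> H d; apply/(IHf _ _ (eq_extend _ _ _ _ d ee')).
- by split=> -[d H]; exists d; apply/(IHf _ _ (eq_extend _ _ _ _ d ee')).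
Qed.

Lemma eq_xholds (dom : Type) (k : nat) (l : xcond dom k) (x x' : k.-tuple dom) :
  (forall j, mentions j l -> tnth x j = tnth x' j) -> xholds x l <-> xholds x' l.
Proof.
elim: l => /= [|i a|l IH|l IH l' IH'|l IH l' IH'] xx'.
- by [].
- by rewrite xx'.
- by have := IH xx'; tauto.
- have := IH (fun j jl => xx' j (or_introl jl)).
  by have := IH' (fun j jl => xx' j (or_intror jl)); tauto.
- have := IH (fun j jl => xx' j (or_introl jl)).
  by have := IH' (fun j jl => xx' j (or_intror jl)); tauto.
Qed.

Lemma closure_set0 (Sg : signature) (dom : Type) (k m : nat)
  (D : set (constraint Sg dom k m)) : Defs.closure set0 D = D.
Proof. by apply/seteqP; split=> [c [] // | c Dc]; apply: closure_base. Qed.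

Section Repair.
Context {Sg : signature} {dom idom : Type} {M : structure Sg idom} {k m : nat}.
Variable Delta : set (constraint Sg dom k m).

Definition uind_target (j : 'I_k) : Prop := exists i, Delta (XUind i j).

(** These are the CDCs whose antecedent may change truth value when target positions are
    overwritten. *)
Definition target_cdc (phi : cdc Sg dom k m) : Prop :=
  Delta (Cdc phi) /\ exists2 j, uind_target j & mentions j (antecedent phi).

Hypothesis disj : forall i j, Delta (XUind i j) -> disjoint_wrt M Delta i j.

Lemma target_cdc_sat phi : target_cdc phi -> satisfiable M (consequent phi).
Proof. by move=> [Dphi [j [i Dij] jphi]]; case: (disj Dij Dphi jphi). Qed.

(** Disjointness applies with the dependency whose target [phi] mentions. An arbitrary [psi] covers
    both uses: target consequents do not conflict, and the other consequents avoid their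
    variables. *)
Lemma target_cdc_disjoint phi psi v : target_cdc phi -> Delta (Cdc psi) ->
  fv (consequent phi) v -> fv (consequent psi) v -> psi = phi.
Proof.
move=> [Dphi [j [i Dij] jphi]] Dpsi phiv psiv.
have [_ dj] := disj Dij Dphi jphi.
apply: contrapT => /(dj _ Dpsi) /seteqP[+ _].
by move=> /(_ v (conj phiv psiv)).
Qed.

(** Models of the target consequents are glued variable by variable; all remaining variables keep
    their value in [y]. *)
Lemma exists_patch (y : m.-tuple idom) : exists y' : m.-tuple idom,
  (forall phi, target_cdc phi -> holds M (consequent phi) (tnth y')) /\
  (forall phi, Delta (Cdc phi) -> ~ target_cdc phi ->
     holds M (consequent phi) (tnth y) -> holds M (consequent phi) (tnth y')).
Proof.
have /choice[e eP] (phi : cdc Sg dom k m) : exists e : 'I_m -> idom,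
    target_cdc phi -> holds M (consequent phi) e.
  have [/target_cdc_sat[e ephi]|nphi] := EM (target_cdc phi); first by exists e.
  (* A mere default: nothing is required of [e] at other CDCs. *)
  by exists (tnth y).
(* A suitable [d] exists because at most one target consequent contains [v]. *)
have /choice[w wP] v : exists d : idom,
    (forall phi, target_cdc phi -> fv (consequent phi) v -> d = e phi v) /\
    ((forall phi, target_cdc phi -> ~ fv (consequent phi) v) -> d = tnth y v).
  have [[phi [tphi phiv]]|nphi] :=
      EM (exists phi, target_cdc phi /\ fv (consequent phi) v).
    exists (e phi v); split=> [psi tpsi psiv|/(_ _ tphi)//].
    by rewrite (target_cdc_disjoint tphi tpsi.1 phiv psiv).
  by exists (tnth y v); split=> // phi tphi phiv; case: nphi; exists phi.
exists [tuple w v | v < m]; split=> [phi tphi | phi Dphi nphi].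
  apply/(@eq_holds _ _ _ _ _ _ (e phi)); last exact: eP.
  by move=> v phiv; rewrite tnth_mktuple; apply: (wP v).1.
move=> yphi; apply/(@eq_holds _ _ _ _ _ _ (tnth y)) => // v phiv.
rewrite tnth_mktuple; apply: (wP v).2 => psi tpsi psiv; apply: nphi.
by rewrite (target_cdc_disjoint tpsi Dphi psiv phiv).
Qed.

Lemma exists_repair (t : fact dom idom k m) :
  sat_all M [set t] (cdcs Delta) ->
  exists R, [/\ finite_set R, R t & sat_all M R Delta].
Proof.
case: t => x y satt; have [y' [y'target y'other]] := exists_patch y.
(* The same [y'] serves for every value [a]. *)
pose u a : fact dom idom k m :=
  ([tuple if `[< uind_target j >] then a else tnth x j | j < k], y').
have u_target a j : uind_target j -> tnth (u a).1 j = a.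
  by move=> jt; rewrite tnth_mktuple; case: asboolP.
have u_other a j : ~ uind_target j -> tnth (u a).1 j = tnth x j.
  by move=> jt; rewrite tnth_mktuple; case: asboolP.
exists ((x, y) |` range (fun i => u (tnth x i))); split; last 1 first.
- move=> [phi|i j] Dc /=.
    have Dphi : cdcs Delta (Cdc phi) by split=> //; exists phi.
    move=> _ [->|[i _ <-]]; first exact: (satt _ Dphi).
    have [tphi _|nphi] := EM (target_cdc phi); first exact: y'target.
    (* The antecedent mentions no target position, so it holds at [x] as well; the CDC at [(x, y)]
       then gives the consequent at [y], which carries over to [y']. *)
    move=> uphi; apply: y'other => //.
    apply: (satt _ Dphi (x, y)) => //.
    apply/(@eq_xholds _ _ _ _ (u (tnth x i)).1) => // j jphi.
    symmetry; apply: u_other => jt.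
    by apply: nphi; split=> //; exists j.
  have jt : uind_target j by exists i.
  (* No new value is ever introduced, and each value of [x] fills all target columns of its own
     added fact. *)
  move=> s Rs; suff [l ->] : exists l, tnth s.1 i = tnth x l.
    by exists (u (tnth x l)); [right; exists l | apply: u_target].
  case: Rs => [->|[l _ <-]]; first by exists i.
  have [it|it] := EM (uind_target i).
    by exists l; rewrite u_target.
  by exists i; rewrite u_other.
- by rewrite finite_setU; split; [apply: finite_set1 | apply: finite_image].
- by left.
Qed.

Lemma lossless_cdcs (p : nat) (Sigma : decomposition Sg dom k m p) :
  lossless M Delta Sigma <-> lossless M (cdcs Delta) Sigma.
Proof.
split=> lossl R V finR finV satR satV t; last first.
  (* Every instance satisfying [Delta] satisfies its CDCs. *)
  by apply: lossl => // c [Dc _]; apply: satR.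
split=> [Rt|[i /satV[]//]].
have satt : sat_all M [set t] (cdcs Delta).
  by move=> c Dc; case: Dc (satR _ Dc) => _ [phi ->] /= H _ ->; apply: H.
have [R' [finR' R't satR']] := exists_repair satt.
(* Selection of [t] depends on [t] alone, so a view that contains it over [R'] also contains it over
   [R]. *)
pose V' i := R' `&` selected M (Sigma i).
have [i [_ ti]] : exists i, V' i t.
  apply/(lossl R' V') => // i.
  by apply: sub_finite_set finR' => s [].
by exists i; apply/satV.
Qed.

End Repair.

Unset Implicit Arguments.

Theorem theorem9 (Sg : signature) (dom idom : Type) (M : structure Sg idom)
    (n k : nat) (hk : k <= n)
    (C : set (formula Sg (n - k))) (hC : closed_under_negation M C)
    (Delta : set (constraint Sg dom k (n - k))) (hfin : finite_set Delta)
    (hDC : consequents_in C Delta)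
    (hdisj : forall i j : 'I_k, Delta (XUind i j) -> disjoint_wrt M Delta i j) :
  separable M C set0 Delta /\
  (forall (p : nat) (Sigma : decomposition Sg dom k (n - k) p),
     decomposition_in C Sigma ->
     (lossless M Delta Sigma <-> lossless M (cdcs Delta) Sigma)).
Proof.
split=> [|p Sigma _]; last exact: lossless_cdcs.
split=> // p Sigma _; rewrite closure_set0; exact: lossless_cdcs.
Qed.
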